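(* Let $R$ be a simple semiring with a projective minimal left (resp. right) ideal. Then $R$ is left (resp. right) perfect if and only if $R$ is an artinian simple ring.
   Context: A semiring $(R,+,\cdot,0,1)$ consists of a commutative monoid $(R,+,0)$ and a monoid $(R,\cdot,1)$ such that multiplication distributes over addition on both sides and $0r=0=r0$ for all $r\in R$. An ideal (left, right ideal) is an additive submonoid closed under two-sided (left, right) multiplication by elements of $R$. $R$ is ideal-simple if $0$ and $R$ are its only ideals; congruence-simple if the diagonal and $R^2$ are its only congruences; simple if it is both. A left $R$-semimodule is a commutative monoid $M$ with a unital, associative scalar multiplication $R\times M\to M$ that is additive in each variable and satisfies $r0_M=0_M=0m$ (right semimodules dually). A semimodule is free if it is a direct sum of copies of the regular semimodule, and projective if it is a retract of a free semimodule. A minimal left (right) ideal is a nonzero left (right) ideal containing no nonzero left (right) ideal properly; it is projective if it is projective as a left (right) $R$-semimodule. A left (right) semimodule is flat if it is a filtered (directed) colimit of finitely generated free semimodules (equivalently, tensoring with it preserves finite limits). $R$ is left (right) perfect if every flat left (right) $R$-semimodule is projective. *)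

(* Defs.v *)
From HB Require Import structures.
From mathcomp Require Import all_boot all_order all_algebra.
From mathcomp Require Import mathcomp_extra boolp classical_sets functions.
From mathcomp Require Import cardinality.

Set Implicit Arguments.
Unset Strict Implicit.
Unset Printing Implicit Defensive.

Import GRing.Theory.

Local Open Scope classical_set_scope.
Local Open Scope ring_scope.

(* Semirings are [pzSemiRingType]s (the trivial semiring is allowed), left
   R-semimodules are [lSemiModType R]s, and right R-semimodules are left
   semimodules over the converse semiring [R^c], in which the product of x and
   y is y * x.  Accordingly each right-handed notion below is its left-handed
   counterpart over [R^c]. *)

Section Ideals.
Variable R : pzSemiRingType.

Definition left_ideal (A : set R) : Prop :=
  [/\ A 0, forall x y, A x -> A y -> A (x + y) & forall r x, A x -> A (r * x)].

Definition minimal_left_ideal (A : set R) : Prop :=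
  [/\ left_ideal A, A <> [set 0] &
      forall B : set R, left_ideal B -> B `<=` A -> B <> [set 0] -> B = A].

Definition left_artinian : Prop :=
  forall A : nat -> set R, (forall n, left_ideal (A n)) ->
    (forall n, A n.+1 `<=` A n) -> exists n, forall m, (n <= m)%N -> A m = A n.

End Ideals.

Definition right_ideal (R : pzSemiRingType) (A : set R) : Prop :=
  @left_ideal R^c A.

Lemma right_idealP (R : pzSemiRingType) (A : set R) :
  right_ideal A <->
  [/\ A 0, forall x y, A x -> A y -> A (x + y) & forall r x, A x -> A (x * r)].
Proof. by []. Qed.

Definition right_artinian (R : pzSemiRingType) : Prop := left_artinian R^c.

Section Simple.
Variable R : pzSemiRingType.

Definition ideal (A : set R) : Prop := left_ideal A /\ right_ideal A.

Definition ideal_simple : Prop :=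
  forall A : set R, ideal A -> A = [set 0] \/ A = setT.

Definition congruence (e : R -> R -> Prop) : Prop :=
  [/\ forall x, e x x, forall x y, e x y -> e y x,
      forall x y z, e x y -> e y z -> e x z &
      forall x x' y y', e x x' -> e y y' ->
        e (x + y) (x' + y') /\ e (x * y) (x' * y')].

Definition congruence_simple : Prop :=
  forall e : R -> R -> Prop, congruence e ->
    (forall x y, e x y <-> x = y) \/ (forall x y, e x y).

Definition simple_semiring : Prop := ideal_simple /\ congruence_simple.

(* Over a ring, [left_ideal], [right_ideal] and [ideal] are the usual ring
   ideals, as - x = (- 1) * x = x * (- 1). *)
Definition is_ring : Prop := forall x : R, exists y : R, x + y = 0.

Definition artinian_simple_ring : Prop :=
  [/\ is_ring, (1 : R) <> 0, ideal_simple, left_artinian R & right_artinian R].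

End Simple.

(* A bundled left ideal coerces to the left R-semimodule it carries. *)
Record leftIdeal (R : pzSemiRingType) := LeftIdeal {
  lideal_set :> set R;
  lideal_setP : left_ideal lideal_set
}.

Section LeftIdealSemimodule.
Variables (R : pzSemiRingType) (I : leftIdeal R).

Definition lideal_pred : {pred R^o} := fun x => x \in lideal_set I.

Definition lideal_mod : Type := {x : R^o | x \in lideal_pred}.

HB.instance Definition _ := SubChoice.on lideal_mod.

Lemma lideal_closed : subsemimod_closed lideal_pred.
Proof.
have inE' (x : R^o) : (x \in lideal_pred) = (x \in lideal_set I) by [].
have [I0 ID IM] := lideal_setP I; split; first split.
- by rewrite inE' mem_set.
- move=> x y; rewrite !inE' => /set_mem Ix /set_mem Iy.
  by apply/mem_set/ID.
- move=> a x; rewrite !inE' => /set_mem Ix; exact/mem_set/IM.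
Qed.

HB.instance Definition _ :=
  GRing.SubChoice_isSubLSemiModule.Build R R^o lideal_pred lideal_mod
    lideal_closed.

End LeftIdealSemimodule.

(* The direct sum of copies of the regular semimodule indexed by I: the
   finitely supported functions I -> R, with pointwise operations. *)
Section DirectSum.
Variables (R : pzSemiRingType) (I : Type).

Definition finsupp : {pred (I -> R)} :=
  fun f => `[< finite_set [set i | f i <> 0] >].

Record dsum : Type := DSum { dsum_val :> I -> R; _ : dsum_val \in finsupp }.

HB.instance Definition _ := [isSub for dsum_val].
HB.instance Definition _ := [Choice of dsum by <:].

Lemma finsupp_closed : Algebra.nmod_closed finsupp.
Proof.
split=> [|f g /asboolP fP /asboolP gP]; apply/asboolP.
  by apply: (sub_finite_set _ (finite_set0 I)) => i /=; apply.
have fgP : finite_set ([set i | f i <> 0] `|` [set i | g i <> 0]).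
  by rewrite finite_setU.
apply: sub_finite_set fgP => i /= fgi.
have [fi0|] := pselect (f i = 0); last by left.
by right=> gi0; apply: fgi; rewrite /GRing.add /= fi0 gi0 addr0.
Qed.

HB.instance Definition _ :=
  GRing.SubChoice_isSubNmodule.Build _ finsupp dsum finsupp_closed.

Lemma finsuppZ (a : R) (f : dsum) : (fun i => a * f i) \in finsupp.
Proof.
case: f => f /= /asboolP fP; apply/asboolP; apply: sub_finite_set fP => i /=.
by apply: contra_not => ->; rewrite mulr0.
Qed.

Definition dsum_scale (a : R) (f : dsum) : dsum := DSum (finsuppZ a f).

Lemma dsum_scaleE a f i : dsum_scale a f i = a * f i. Proof. by []. Qed.

Lemma dsumP (f g : dsum) : f =1 g -> f = g.
Proof. by move=> fg; apply/val_inj/funext. Qed.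

Lemma dsum0E i : (0 : dsum) i = 0.
Proof. by rewrite -[dsum_val _]/(val (0 : dsum)) raddf0. Qed.

Lemma dsumDE (f g : dsum) i : (f + g) i = f i + g i.
Proof. by rewrite -[dsum_val _]/(val (f + g)) raddfD. Qed.

Lemma dsum_scaleA a b f :
  dsum_scale a (dsum_scale b f) = dsum_scale (a * b) f.
Proof. by apply: dsumP => i /=; rewrite mulrA. Qed.

Lemma dsum_scale0 f : dsum_scale 0 f = 0.
Proof. by apply: dsumP => i; rewrite dsum0E /= mul0r. Qed.

Lemma dsum_scale1 : left_id 1 dsum_scale.
Proof. by move=> f; apply: dsumP => i /=; rewrite mul1r. Qed.

Lemma dsum_scaleDr : right_distributive dsum_scale +%R.
Proof. by move=> a f g; apply: dsumP => i; rewrite dsumDE !dsum_scaleE dsumDE mulrDr. Qed.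

Lemma dsum_scaleDl f : {morph dsum_scale^~ f : a b / a + b}.
Proof. by move=> a b; apply: dsumP => i; rewrite dsumDE /= mulrDl. Qed.

HB.instance Definition _ := GRing.Nmodule_isLSemiModule.Build R dsum
  dsum_scaleA dsum_scale0 dsum_scale1 dsum_scaleDr dsum_scaleDl.

Lemma dsumZE a (f : dsum) i : (a *: f) i = a * f i.
Proof. by []. Qed.

End DirectSum.

Section Semimodules.
Variable R : pzSemiRingType.

Definition isomorphic (M N : lSemiModType R) : Prop :=
  exists f : {linear M -> N}, bijective f.

Definition free_semimodule (M : lSemiModType R) : Prop :=
  exists I : Type, isomorphic M (dsum R I).

Definition fg_free_semimodule (M : lSemiModType R) : Prop :=
  exists n : nat, isomorphic M (dsum R 'I_n).

Definition projective (M : lSemiModType R) : Prop :=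
  exists (F : lSemiModType R) (i : {linear M -> F}) (p : {linear F -> M}),
    free_semimodule F /\ cancel i p.

Record directed_system := DirectedSystem {
  ds_index : Type;
  ds_le : ds_index -> ds_index -> Prop;
  ds_obj : ds_index -> lSemiModType R;
  ds_map : forall i j, ds_le i j -> {linear ds_obj i -> ds_obj j};
  ds_inhabited : inhabited ds_index;
  ds_le_refl : forall i, ds_le i i;
  ds_le_trans : forall i j k, ds_le i j -> ds_le j k -> ds_le i k;
  ds_directed : forall i j, exists k, ds_le i k /\ ds_le j k;
  ds_map_id : forall i (ii : ds_le i i) x, ds_map ii x = x;
  ds_map_comp : forall i j k (ij : ds_le i j) (jk : ds_le j k) (ik : ds_le i k)
    x, ds_map jk (ds_map ij x) = ds_map ik x
}.

Arguments ds_obj : clear implicits.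

Definition is_cocone (D : directed_system) (M : lSemiModType R)
    (c : forall i, {linear ds_obj D i -> M}) : Prop :=
  forall i j (ij : ds_le i j) x, c j (ds_map ij x) = c i x.

Definition is_colimit (D : directed_system) (M : lSemiModType R)
    (c : forall i, {linear ds_obj D i -> M}) : Prop :=
  is_cocone c /\
  forall (N : lSemiModType R) (d : forall i, {linear ds_obj D i -> N}),
    is_cocone d ->
    exists u : {linear M -> N}, (forall i x, u (c i x) = d i x) /\
      forall v : {linear M -> N}, (forall i x, v (c i x) = d i x) -> v =1 u.

Definition flat (M : lSemiModType R) : Prop :=
  exists (D : directed_system) (c : forall i, {linear ds_obj D i -> M}),
    (forall i, fg_free_semimodule (ds_obj D i)) /\ is_colimit c.

Definition left_perfect : Prop :=
  forall M : lSemiModType R, flat M -> projective M.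

Definition has_projective_minimal_left_ideal : Prop :=
  exists I : leftIdeal R, minimal_left_ideal I /\ projective (lideal_mod I).

End Semimodules.

Arguments ds_obj {R} _ _.

Definition right_perfect (R : pzSemiRingType) : Prop := left_perfect R^c.

Definition has_projective_minimal_right_ideal (R : pzSemiRingType) : Prop :=
  has_projective_minimal_left_ideal R^c.

(* Main.v *)
Require Import Defs.
From mathcomp Require Import all_boot all_order all_algebra.
From HB Require Import structures.
From mathcomp Require Import boolp classical_sets functions cardinality fsbigop.

(* A projective minimal left ideal is isomorphic to R e for an idempotent e such
   that e R e is a division semiring, and 1 = \sum_k a_k e b_k since R is
   ideal-simple.  The elements with an additive opposite form an ideal, so R is
   either a ring or zerosumfree.
   - If R is a ring, R is a finite sum of the minimal left ideals R e b_k, hence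
     left artinian, and right artinian because the conditions on e are
     symmetric; a maximal partial section of a surjection onto an R-module is
     total, as it could otherwise be extended to some minimal submodule R e x.
   - If R is zerosumfree, congruence-simplicity forces e R e = {0, e} and
     x + x = x.  The semimodule of eventually constant sequences in R is a
     directed union of finitely generated free ones, but it is not projective:
     below e (1, 1, ...) it has infinitely many elements of the form e f,
     whereas a free semimodule has only finitely many below a given one. *)

Set Implicit Arguments.
Unset Strict Implicit.
Unset Printing Implicit Defensive.

Import GRing.Theory.

Local Open Scope classical_set_scope.
Local Open Scope ring_scope.

(** * Idempotents with a division corner *)

Definition division_idempotent (R : pzSemiRingType) (e : R) : Prop :=
  [/\ e <> 0, e * e = e &
      forall x, e * x * e <> 0 -> exists y, y * (e * x * e) = e].

Definition full_element (R : pzSemiRingType) (e : R) : Prop :=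
  exists s : seq (R * R), 1 = \sum_(p <- s) p.1 * e * p.2.

(** As in a group, a left inverse in [e R e] that has a left inverse itself is also a right
    inverse. *)
Lemma division_idempotent_conv (R : pzSemiRingType) (e : R) :
  division_idempotent e -> division_idempotent (e : R^c).
Proof.
move=> [e0 ee inve]; split=> // x u0.
set u := (e * x * e : R).
have u_neq0 : u <> 0 by move=> u00; apply: u0; rewrite -[RHS]u00 /u -mulrA.
have [y yu] := inve _ u_neq0.
have eu : e * u = u by rewrite /u !mulrA ee.
have ue : u * e = u by rewrite /u -!mulrA ee.
set v := e * y * e.
have vu : v * u = e by rewrite /v -!mulrA eu yu ee.
have v0 : v <> 0 by move=> v00; apply: e0; rewrite -vu v00 mul0r.
have [z zv] := inve _ v0; rewrite -/v in zv.
have ev : e * v = v by rewrite /v !mulrA ee.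
have zu : z * e = u by rewrite -vu mulrA zv eu.
exists (v : R^c).
suff uv : u * v = e by rewrite -[RHS]uv /u -[e * x * e]mulrA.
by rewrite -zu -mulrA ev zv.
Qed.

(** The sums of terms [a * e * b] form an ideal containing [e], hence all of [R]. *)
Lemma full_of_ideal_simple (R : pzSemiRingType) (e : R) :
  ideal_simple R -> e <> 0 -> full_element e.
Proof.
move=> simR e0.
pose A : set R := [set x | exists s : seq (R * R),
  x = \sum_(p <- s) p.1 * e * p.2].
have AD x y : A x -> A y -> A (x + y).
  by move=> [s ->] [t ->]; exists (s ++ t); rewrite big_cat.
have A0 : A 0 by exists [::]; rewrite big_nil.
have idA : ideal A.
  split; [|apply/right_idealP]; split=> // r x [s ->].
    exists [seq (r * p.1, p.2) | p <- s].
    by rewrite big_map mulr_sumr; apply: eq_bigr => p _ /=; rewrite !mulrA.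
  exists [seq (p.1, p.2 * r) | p <- s].
  by rewrite big_map mulr_suml; apply: eq_bigr => p _ /=; rewrite !mulrA.
have [A00|AT] := simR A idA.
  have : A e by exists [:: (1, 1)]; rewrite big_seq1 mul1r mulr1.
  by rewrite A00.
by have : A 1 by rewrite AT.
Qed.

Section FullDivisionIdempotent.
Variables (R : pzSemiRingType) (e : R).
Hypotheses (dive : division_idempotent e) (fulle : full_element e).

Lemma corner_mul_neq0 x y :
  e * x * e <> 0 -> e * y * e <> 0 -> (e * x * e) * (e * y * e) <> 0.
Proof.
have [_ ee inve] := dive => /inve[z zx] y0 xy0; apply: y0.
have -> : e * y * e = z * (e * x * e) * (e * y * e) by rewrite zx !mulrA ee.
by rewrite -mulrA xy0 mulr0.
Qed.

(** By fullness some corner entry [e * t * (r * e)] is nonzero, and it can be inverted. So every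
    nonzero element of [R e] generates [R e]. *)
Lemma full_left_inverse r : r * e <> 0 -> exists s, s * r * e = e.
Proof.
have [_ ee inve] := dive; have [s s1] := fulle => re0.
have [t te] : exists t, e * t * (r * e) <> 0.
  apply: contra_notP re0 => /forallNP re0.
  rewrite -[r * e]mul1r s1 mulr_suml big1// => p _.
  by rewrite -!mulrA [e * _]mulrA; have /contrapT -> := re0 p.2; rewrite mulr0.
have [|y yE] := inve (t * r); first by rewrite -!mulrA mulrA.
by exists (y * e * t); rewrite -[RHS]yE !mulrA.
Qed.

End FullDivisionIdempotent.

(** * The descending chain condition over a ring *)

Section RingArtinian.
Variables (R : pzSemiRingType) (e : R).
Hypotheses (dive : division_idempotent e) (fulle : full_element e).
Hypothesis ringR : is_ring R.

Fixpoint left_span (s : seq R) : set R :=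
  if s is b :: s' then [set x | exists r y, left_span s' y /\ x = r * e * b + y]
  else [set 0].

Lemma left_span_ideal s : left_ideal (left_span s).
Proof.
elim: s => [|b s [s0 sD sM]] /=.
  by split=> // [x y -> ->|r x ->]; rewrite ?addr0 ?mulr0.
split.
- by exists 0, 0; rewrite !mul0r addr0.
- move=> x y [r [x' [sx ->]]] [t [y' [sy ->]]]; exists (r + t), (x' + y').
  by split; [exact: sD | rewrite !mulrDl addrACA].
- move=> t x [r [x' [sx ->]]]; exists (t * r), (t * x').
  by split; [exact: sM | rewrite mulrDr !mulrA].
Qed.

Lemma left_span_full : exists s, left_span s = setT.
Proof.
have [s s1] := fulle; exists (map snd s); apply/seteqP; split=> // x _.
rewrite -[x]mulr1 s1 mulr_sumr => {s1}; elim: s => [|p s IHs].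
  by rewrite big_nil.
by rewrite big_cons; exists (x * p.1), (\sum_(q <- s) x * (q.1 * e * q.2));
  rewrite !mulrA.
Qed.

(** Induction on [s]. Unless some term lies in the span of the tail, every term has an element
    outside it, whose coefficient [t * e] at the head is nonzero; the chain is then stationary as
    soon as its trace on the tail span is. *)
Lemma left_span_artinian s (A : nat -> set R) :
    (forall n, left_ideal (A n)) -> (forall n, A n.+1 `<=` A n) ->
    A 0%N `<=` left_span s ->
  exists n, forall m, (n <= m)%N -> A m = A n.
Proof.
have subA (B : nat -> set R) (decB : forall n, B n.+1 `<=` B n) n m :
    (n <= m)%N -> B m `<=` B n.
  elim: m => [|m IHm]; first by rewrite leqn0 => /eqP->.
  rewrite leq_eqVlt => /predU1P[->//|/IHm]; exact: subset_trans.
(* [N] plays the role of -1. *)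
have [N N1] := ringR 1.
elim: s A => [|b s IHs] A idA decA A0.
  have AE n : A n = [set 0].
    apply/seteqP; split; first exact: subset_trans (subA A decA 0%N n isT) A0.
    by move=> _ ->; case: (idA n).
  by exists 0%N => m _; rewrite !AE.
have [s0 sD sM] := left_span_ideal s.
have [[n0 An0]|nA] := pselect (exists n, A n `<=` left_span s).
  have [|||n nP] := IHs (fun n => A (n0 + n)%N).
  - by move=> n; exact: idA.
  - by move=> n; rewrite addnS; exact: decA.
  - by rewrite addn0.
  - exists (n0 + n)%N => m nm.
    have -> : m = (n0 + (m - n0))%N.
      by rewrite subnKC// (leq_trans _ nm)// leq_addr.
    by apply: nP; rewrite leq_subRL ?(leq_trans _ nm)// leq_addr.
have [|||n nP] := IHs (fun n => A n `&` left_span s).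
- move=> n; have [An0 AnD AnM] := idA n; split=> [|x y [? ?] [? ?]|r x [? ?]].
  + by split.
  + by split; [exact: AnD | exact: sD].
  + by split; [exact: AnM | exact: sM].
- by move=> n x [/decA].
- by move=> x [].
exists n => m nm; apply/seteqP; split; first exact: subA.
move=> x Anx.
have [r [y [sy xE]]] := A0 _ (subA A decA 0%N n isT _ Anx).
have [Am0 AmD AmM] := idA m; have [An0 AnD AnM] := idA n.
have [a [Ama asN]] : exists a, A m a /\ ~ left_span s a.
  apply: contra_notP nA => /forallNP H; exists m => a Ama.
  by apply: contrapT => sa; apply: (H a).
have [t [z [sz aE]]] := A0 _ (subA A decA 0%N m isT _ Ama).
have [|u uE] := @full_left_inverse _ _ dive fulle t.
  by move=> te0; apply: asN; rewrite aE te0 mul0r add0r.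
(* [w] has the same head term [r * e * b] as [x], because [u * t * e = e]. *)
pose w := r * e * u * a.
have wE : w = r * e * b + r * e * u * z.
  by rewrite /w aE mulrDr !mulrA -[r * e * u * t * e]mulrA -[r * e * u * _]mulrA
     [u * _]mulrA uE -[r * e * e]mulrA; have [_ -> _] := dive.
have Amw : A m w by apply: AmM.
(* Subtracting [w] moves [x] into the tail span, where [A n] and [A m] agree. *)
have [] : (A m `&` left_span s) (x + N * w).
  rewrite nP//; split.
    apply: AnD => //; apply: AnM; exact: subA nm _ Amw.
  rewrite xE wE mulrDr addrACA -[X in X + _ + _]mul1r -mulrDl N1 mul0r add0r.
  by apply: sD => //; exact/sM/sM.
move=> Amxw _; rewrite -[x]addr0 -[0](mul0r w) -N1 [1 + N]addrC mulrDl mul1r addrA.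
exact: AmD.
Qed.

Lemma left_artinian_of_full : left_artinian R.
Proof.
move=> A idA decA; have [s sT] := left_span_full.
by apply: (@left_span_artinian s) => //; rewrite sT.
Qed.

End RingArtinian.

(** * Rings versus zerosumfree semirings *)

Lemma ring_or_zerosumfree (R : pzSemiRingType) :
  ideal_simple R -> is_ring R \/ forall x y : R, x + y = 0 -> x = 0.
Proof.
move=> simR; pose V : set R := [set x | exists y, x + y = 0].
have idV : ideal V.
  have V0 : V 0 by exists 0; rewrite addr0.
  have VD x y : V x -> V y -> V (x + y).
    move=> [x' xx'] [y' yy']; exists (x' + y').
    by rewrite addrACA xx' yy' addr0.
  split; [|apply/right_idealP]; split=> // r x [y xy].
    by exists (r * y); rewrite -mulrDr xy mulr0.
  by exists (y * r); rewrite -mulrDl xy mul0r.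
have [V0|VT] := simR V idV; [right=> x y xy | left=> x].
  by have : V x by [exists y]; rewrite V0.
by have : V x by rewrite VT.
Qed.

(** * Linear maps out of free semimodules *)

Section LinearOf.
Variables (R : pzSemiRingType) (U V : lSemiModType R) (f : U -> V).
Hypotheses (fZ : forall a u, f (a *: u) = a *: f u).
Hypothesis fD : {morph f : x y / x + y}.

Definition linear_of : {linear U -> V} :=
  HB.pack f (GRing.isSemilinear.Build R U V *:%R f (fZ, fD)).

End LinearOf.

Section DsumUniversal.
Variables (R : pzSemiRingType) (I : Type).

Definition dsum_delta_fun (i : I) : I -> R :=
  fun j => if `[< j = i >] then 1 else 0.

Lemma dsum_delta_subproof i : dsum_delta_fun i \in finsupp (I := I).
Proof.
apply/asboolP; apply: sub_finite_set (finite_set1 i) => j /=.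
by rewrite /dsum_delta_fun; case: asboolP.
Qed.

Definition dsum_delta i : dsum R I := DSum (dsum_delta_subproof i).

Lemma dsum_finite (f : dsum R I) : finite_set [set i | f i <> 0].
Proof. by case: f => f /= /asboolP. Qed.

Lemma dsum_deltaZ (f : dsum R I) (s : seq {classic I}) : uniq s ->
  [set i | f i <> 0] `<=` [set` s] -> f = \sum_(i <- s) f i *: dsum_delta i.
Proof.
move=> us fs; apply: dsumP => j.
have -> : (\sum_(i <- s) f i *: dsum_delta i) j =
    \sum_(i <- s) f i * dsum_delta_fun i j.
  elim: (s) => [|i t IHt]; first by rewrite !big_nil dsum0E.
  by rewrite !big_cons dsumDE IHt.
have [js|js] := boolP ((j : {classic I}) \in s).
  rewrite (bigD1_seq _ js us) /= big1 ?addr0 => [|i /eqP ij].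
    by rewrite /dsum_delta_fun asboolT ?mulr1.
  by rewrite /dsum_delta_fun asboolF ?mulr0// => ji; apply: ij.
rewrite big1_seq => [|i /andP[_ si]].
  by apply: contrapT => /fs; apply/negP.
rewrite /dsum_delta_fun asboolF ?mulr0// => ji.
by move: js; rewrite ji si.
Qed.

Variable M : lSemiModType R.

Lemma linear_dsum_ext (g h : {linear dsum R I -> M}) :
  (forall i, g (dsum_delta i) = h (dsum_delta i)) -> g =1 h.
Proof.
move=> gh f; have /(@finite_seqP {classic I})[s sE] := dsum_finite f.
rewrite (@dsum_deltaZ f (undup s)) ?undup_uniq//.
  by rewrite !linear_sum; apply: eq_bigr => i _; rewrite !linearZ/= gh.
by rewrite sE => i /=; rewrite mem_undup.
Qed.

Variable v : I -> M.

(** Only finitely many terms are nonzero, so no enumeration of the support has to be chosen. *)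
Definition dsum_lift_fun (f : dsum R I) : M :=
  \sum_(i \in [set: {classic I}]) f i *: v i.

Lemma dsum_lift_funE (f : dsum R I) (s : seq {classic I}) : uniq s ->
  [set i | f i <> 0] `<=` [set` s] ->
  dsum_lift_fun f = \sum_(i <- s) f i *: v i.
Proof.
move=> us fs; rewrite /dsum_lift_fun [RHS]fsbig_seq//.
rewrite [RHS](fsbig_widen _ [set: {classic I}])// => i [_ /= si]; have [->|/fs//] := pselect (f i = 0).
by rewrite scale0r.
Qed.

Lemma dsum_supp_seq (f : dsum R I) :
  exists2 s : seq {classic I}, uniq s & [set i | f i <> 0] `<=` [set` s].
Proof.
have /(@finite_seqP {classic I})[s sE] := dsum_finite f.
by exists (undup s); rewrite ?undup_uniq// sE => i /=; rewrite mem_undup.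
Qed.

Lemma dsum_lift_funZ a f : dsum_lift_fun (a *: f) = a *: dsum_lift_fun f.
Proof.
have [s us fs] := dsum_supp_seq f; rewrite !(dsum_lift_funE us)//.
  by rewrite scaler_sumr; apply: eq_bigr => i _; rewrite scalerA.
move=> i /= afi; apply: fs => /=; apply: contra_not afi => fi.
by rewrite fi mulr0.
Qed.

Lemma dsum_lift_funD : {morph dsum_lift_fun : f g / f + g}.
Proof.
move=> f g; have [s us fs] := dsum_supp_seq f.
have [t ut gt] := dsum_supp_seq g.
have ust : uniq (undup (s ++ t)) by rewrite undup_uniq.
have subst (h : dsum R I) : (forall i, h i <> 0 -> f i <> 0 \/ g i <> 0) ->
    [set i | h i <> 0] `<=` [set` undup (s ++ t)].
  move=> hfg i /hfg /=; rewrite mem_undup mem_cat.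
  by move=> [/fs|/gt] /= -> //; rewrite orbT.
rewrite !(dsum_lift_funE ust).
- by rewrite -big_split; apply: eq_bigr => i _; rewrite dsumDE scalerDl.
- by apply: subst => i; right.
- by apply: subst => i; left.
- apply: subst => i; rewrite dsumDE => fgi; apply/not_andP => -[fi gi].
  by apply: fgi; rewrite fi gi addr0.
Qed.

Definition dsum_lift : {linear dsum R I -> M} :=
  linear_of dsum_lift_funZ dsum_lift_funD.

Lemma dsum_liftE i : dsum_lift (dsum_delta i) = v i.
Proof.
rewrite [LHS](@dsum_lift_funE _ [:: i : {classic I}])// => [|j /=].
  by rewrite big_seq1 /= /dsum_delta_fun asboolT ?scale1r.
by rewrite /dsum_delta_fun inE; case: asboolP => // -> _; rewrite eqxx.
Qed.

End DsumUniversal.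

(** * Idempotents from projective minimal left ideals *)

Lemma projectiveP (R : pzSemiRingType) (M : lSemiModType R) : projective M <->
  exists (I : Type) (i : {linear M -> dsum R I}) (p : {linear dsum R I -> M}),
    cancel i p.
Proof.
split=> [[F [i [p [[I [f [g fK gK]]] ip]]]]|[I [i [p ip]]]].
  have gZ a u : g (a *: u) = a *: g u.
    by apply: (can_inj fK); rewrite linearZ !gK.
  have gD : {morph g : x y / x + y}.
    by move=> x y; apply: (can_inj fK); rewrite linearD !gK.
  exists I, (f \o i), (p \o linear_of gZ gD) => x /=.
  by rewrite fK ip.
exists (dsum R I), i, p; split=> //; exists I, (@idfun (dsum R I)).
by exists id.
Qed.

(* The dual basis of a projective minimal left ideal [R x] gives [w] with
   [R x] isomorphic to [R w] through [r * x <-> r * w]. *)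
Lemma division_idempotent_of_projective (R : pzSemiRingType) :
  has_projective_minimal_left_ideal R -> exists e : R, division_idempotent e.
Proof.
move=> [[J idJ] [[/= _ J0 minJ] /projectiveP[I [i [p ip]]]]].
have [A0 AD AM] := idJ.
have [x Jx x0] : exists2 x, J x & x <> 0.
  apply: contra_notP J0 => H; apply/seteqP; split=> [x Jx|_ -> //].
  by apply: contrapT => x0; apply: H; exists x.
have genJ y : J y -> y <> 0 -> forall z, J z -> exists r, z = r * y.
  move=> Jy y0 z; suff <- : [set z | exists r, z = r * y] = J by [].
  apply: minJ => [|_ [r ->]|Y0]; last 2 first.
  - exact: AM.
  - by apply: y0; rewrite -[y = 0]/([set 0] y) -Y0; exists 1; rewrite mul1r.
  - split=> [|_ _ [r ->] [s ->]|s _ [r ->]].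
    + by exists 0; rewrite mul0r.
    + by exists (r + s); rewrite mulrDl.
    + by exists (s * r); rewrite mulrA.
have sJ (u : lideal_mod (LeftIdeal idJ)) : J (val u) by case: u => u /= /set_mem.
(* Since [J = R x], the map [p] is [f |-> q f * x] for the linear form [q] with coefficients [t]. *)
have /choice[t tE] : forall j, exists r, val (p (dsum_delta R j)) = r * x.
  by move=> j; apply: genJ.
pose q : {linear dsum R I -> R^o} := dsum_lift (t : I -> R^o).
have pq f : val (p f) = q f * x.
  pose mulx (u : R^o) : R^o := u * x.
  have mulxZ a u : mulx (a *: u) = a *: mulx u by exact: esym (mulrA _ _ _).
  have mulxD : {morph mulx : u w / u + w} by move=> u w; exact: mulrDl.
  apply: (@linear_dsum_ext R I R^o (val \o p) (linear_of mulxZ mulxD \o q)).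
  move=> j; have qj : q (dsum_delta R j) = t j by exact: dsum_liftE.
  by rewrite [LHS]tE -qj.
pose X : lideal_mod (LeftIdeal idJ) := Sub (x : R^o) (mem_set Jx).
pose w : R := q (i X).
have wx : w * x = x by have := pq (i X); rewrite ip => /esym.
(* The map [r * x |-> r * w] is well defined, being the restriction of [q \o i]. *)
have wP r s : r * x = s * x -> r * w = s * w.
  move=> rs; have : r *: X = s *: X by apply: val_inj; rewrite !linearZ; exact: rs.
  have qiZ a : q (i (a *: X)) = a * w by rewrite linearZ [LHS]linearZ.
  by rewrite -!qiZ => ->.
exists w; split.
- by move=> w0; apply: x0; rewrite -wx w0 mul0r.
- by rewrite -[RHS]mul1r; apply: wP; rewrite wx mul1r.
- move=> r wrw0.
  (* Minimality gives [x = s * (w * r * x)], which transfers to [w = s * (w * r * w)]. *)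
  have [||s sE] := genJ (w * r * x) _ _ x Jx.
  + exact: AM.
  + by move=> wrx; apply: wrw0; rewrite -[RHS](mul0r w); apply: wP; rewrite wrx mul0r.
  + exists s; rewrite mulrA -[RHS]mul1r; apply: wP.
    by rewrite mul1r [RHS]sE !mulrA.
Qed.

(** * Projectivity of all modules over the ring *)

Section RingProjective.
Variables (R : pzSemiRingType) (e : R).
Hypotheses (dive : division_idempotent e) (fulle : full_element e).
Hypothesis ringR : is_ring R.

(* A maximal partial linear section of [p], as a graph, is total. *)
Lemma linear_section (M F : lSemiModType R) (p : {linear F -> M}) :
  (forall m, exists f, p f = m) -> exists i : {linear M -> F}, cancel i p.
Proof.
move=> p_surj; have [N N1] := ringR 1.
have addN (V : lSemiModType R) (v : V) : v + N *: v = 0.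
  by rewrite -[X in X + _]scale1r -scalerDl N1 scale0r.
pose P (G : set (M * F)) := [/\ forall m f m' f', G (m, f) -> G (m', f') ->
  G (m + m', f + f'), forall a m f, G (m, f) -> G (a *: m, a *: f),
  forall m f, G (m, f) -> p f = m & forall m f f', G (m, f) -> G (m, f') -> f = f'].
have [C CP Ctot|G [[GD GZ Gp Gfun] maxG]] := @Zorn_bigcup _ P.
  have two u v : (\bigcup_(X in C) X) u -> (\bigcup_(X in C) X) v ->
      exists X, [/\ C X, X u & X v].
    move=> [X CX Xu] [Y CY Yv].
    have [XY|YX] := Ctot X Y CX CY; first by exists Y; split=> //; exact: XY.
    by exists X; split=> //; exact: YX.
  split=> [m f m' f' u v|a m f [X CX Xu]|m f [X CX Xu]|m f f' u v].
  - have [X [CX Xu Xv]] := two _ _ u v; exists X => //.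
    by have [XD _ _ _] := CP X CX; exact: XD.
  - by exists X => //; have [_ XZ _ _] := CP X CX; exact: XZ.
  - by have [_ _ Xp _] := CP X CX; exact: Xp.
  - have [X [CX Xu Xv]] := two _ _ u v.
    by have [_ _ _ Xf] := CP X CX; apply: Xf Xu Xv.
(* The empty graph also satisfies [P]; maximality excludes it. *)
have G0 : G (0, 0).
  apply: contrapT => G0.
  have GE u : ~ G u by case: u => m f /(GZ 0); rewrite !scale0r.
  apply: (maxG [set (0, 0)]); first by split=> [u /GE//|/(_ (0, 0) erefl)/G0].
  split=> [m f m' f' [-> ->] [-> ->]|a m f [-> ->]|m f [-> ->]|m f f' [_ ->] [_ ->]//].
  - by rewrite !addr0.
  - by rewrite !scaler0.
  - by rewrite linear0.
(* Otherwise [G] extends by [(r * e) *: x |-> (r * e) *: y], as its domain meets [R e x] only in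
   0. *)
have Ge x : exists f, G (e *: x, f).
  apply: contrapT => /forallNP Gx; have [y yx] := p_surj x.
  pose H : set (M * F) := [set u | exists m f r,
    G (m, f) /\ u = (m + (r * e) *: x, f + (r * e) *: y)].
  have reP r f : G ((r * e) *: x, f) -> r * e = 0.
    move=> Gr; apply: contrapT => re0.
    have [s sE] := full_left_inverse dive fulle re0.
    by apply: (Gx (s *: f)); rewrite -sE -mulrA -scalerA; exact: GZ.
  apply: (maxG H).
    split=> [[m f] Gm|HG]; first by exists m, f, 0; rewrite mul0r !scale0r !addr0.
    apply: (Gx (e *: y)); apply: HG; exists 0, 0, 1.
    by rewrite mul1r !add0r.
  split.
  - move=> _ _ _ _ [m [f [r [Gm [-> ->]]]]] [m' [f' [r' [Gm' [-> ->]]]]].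
    exists (m + m'), (f + f'), (r + r'); split; first exact: GD.
    by rewrite mulrDl !scalerDl (addrACA m) (addrACA f).
  - move=> a _ _ [m [f [r [Gm [-> ->]]]]].
    exists (a *: m), (a *: f), (a * r); split; first exact: GZ.
    by rewrite !scalerDr !scalerA mulrA.
  - move=> _ _ [m [f [r [Gm [-> ->]]]]].
    by rewrite linearD linearZ /= yx (Gp _ _ Gm).
  - move=> _ _ _ [m [f [r [Gm [-> ->]]]]] [m' [f' [r' [Gm' [E ->]]]]].
    (* Single-valuedness: the difference of the two coefficients sends [x] into the domain of [G],
       so it vanishes. *)
    have re : r * e = r' * e.
      have : (r + N * r') * e = 0.
        apply: (reP _ (f' + N *: f)).
        suff -> : ((r + N * r') * e) *: x = m' + N *: m.
          by apply: GD => //; apply: GZ.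
        rewrite mulrDl scalerDl -[N * _ * _]mulrA -(scalerA N).
        by rewrite -[LHS]add0r -(addN _ m) addrACA E addrACA addN addr0.
      move=> rr'; rewrite -[LHS]addr0 -[0](mul0r (r' * e)) -N1 mulrDl mul1r.
      by rewrite [r' * e + _]addrC addrA mulrA -mulrDl rr' add0r.
    rewrite -re in E *; congr (_ + _).
    have mm' : m = m'.
      rewrite -[LHS]addr0 -(addN _ ((r * e) *: x)) addrA E -addrA addN.
      by rewrite addr0.
    by apply: Gfun Gm _; rewrite mm'.
have Gall x : exists f, G (x, f).
  (* Fullness writes [x] as a sum of terms [a *: (e *: (b *: x))]. *)
  have [s s1] := fulle; rewrite -[x]scale1r s1 scaler_suml.
  elim: s {s1} => [|a s [f Gf]]; first by exists 0; rewrite big_nil.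
  have [g Gg] := Ge (a.2 *: x).
  exists (a.1 *: g + f); rewrite big_cons; apply: GD => //.
  by rewrite -!scalerA; exact: GZ.
have /choice[i iP] := Gall.
have iZ a u : i (a *: u) = a *: i u by apply: Gfun (iP _) _; exact: GZ.
have iD : {morph i : x y / x + y}.
  by move=> x y; apply: Gfun (iP _) _; exact: GD.
by exists (linear_of iZ iD) => x; exact: Gp (iP x).
Qed.

(** The canonical surjection from the free module on the elements of [M] splits. *)
Lemma projective_of_full (M : lSemiModType R) : projective M.
Proof.
apply/projectiveP.
have [|i ip] := @linear_section M _ (@dsum_lift R M M id).
  by move=> m; exists (dsum_delta R m); rewrite dsum_liftE.
by exists M, i, (dsum_lift id).
Qed.

End RingProjective.

(** * Flatness of the eventually constant sequences *)

Section EventuallyConstant.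
Variable R : pzSemiRingType.

Definition evconst_pred : {pred nat -> R} :=
  fun f => `[< exists n, forall k, (n <= k)%N -> f k = f n >].

Record evconst : Type := EvConst {
  evconst_val :> nat -> R; _ : evconst_val \in evconst_pred }.

HB.instance Definition _ := [isSub for evconst_val].
HB.instance Definition _ := [Choice of evconst by <:].

Lemma evconst_closed : Algebra.nmod_closed evconst_pred.
Proof.
split=> [|f g /asboolP[n fn] /asboolP[m gm]]; apply/asboolP; first by exists 0%N.
exists (maxn n m) => k; rewrite geq_max => /andP[nk mk].
by rewrite /GRing.add /= !(fn k, fn (maxn n m), gm k, gm (maxn n m))// ?leq_maxl ?leq_maxr.
Qed.

HB.instance Definition _ :=
  GRing.SubChoice_isSubNmodule.Build _ evconst_pred evconst evconst_closed.

Lemma evconst_scale_subproof (a : R) (f : evconst) :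
  (fun k => a * f k) \in evconst_pred.
Proof.
by case: f => f /= /asboolP[n fn]; apply/asboolP; exists n => k /fn ->.
Qed.

Definition evconst_scale (a : R) (f : evconst) : evconst :=
  EvConst (evconst_scale_subproof a f).

Lemma evconst_scaleE a f k : evconst_scale a f k = a * f k. Proof. by []. Qed.

Lemma evconstP (f g : evconst) : f =1 g -> f = g.
Proof. by move=> fg; apply/val_inj/funext. Qed.

Lemma evconst0E k : (0 : evconst) k = 0.
Proof. by rewrite -[evconst_val _]/(val (0 : evconst)) raddf0. Qed.

Lemma evconstDE (f g : evconst) k : (f + g) k = f k + g k.
Proof. by rewrite -[evconst_val _]/(val (f + g)) raddfD. Qed.

Lemma evconst_scaleA a b f :
  evconst_scale a (evconst_scale b f) = evconst_scale (a * b) f.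
Proof. by apply: evconstP => k /=; rewrite mulrA. Qed.

Lemma evconst_scale0 f : evconst_scale 0 f = 0.
Proof. by apply: evconstP => k; rewrite evconst0E /= mul0r. Qed.

Lemma evconst_scale1 : left_id 1 evconst_scale.
Proof. by move=> f; apply: evconstP => k /=; rewrite mul1r. Qed.

Lemma evconst_scaleDr : right_distributive evconst_scale +%R.
Proof.
by move=> a f g; apply: evconstP => k; rewrite evconstDE !evconst_scaleE evconstDE mulrDr.
Qed.

Lemma evconst_scaleDl f : {morph evconst_scale^~ f : a b / a + b}.
Proof. by move=> a b; apply: evconstP => k; rewrite evconstDE /= mulrDl. Qed.

HB.instance Definition _ := GRing.Nmodule_isLSemiModule.Build R evconst
  evconst_scaleA evconst_scale0 evconst_scale1 evconst_scaleDr evconst_scaleDl.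

Lemma evconstZE a (f : evconst) k : (a *: f) k = a * f k. Proof. by []. Qed.

Section Reindex.
Variables (I : Type) (J : finType) (h : J -> I).

Lemma dsum_reindex_subproof (f : dsum R I) : f \o h \in finsupp (I := J).
Proof. by apply/asboolP; exact: finite_finset. Qed.

Definition dsum_reindex_fun (f : dsum R I) : dsum R J :=
  DSum (dsum_reindex_subproof f).

Lemma dsum_reindex_funZ a f :
  dsum_reindex_fun (a *: f) = a *: dsum_reindex_fun f.
Proof. exact: dsumP. Qed.

Lemma dsum_reindex_funD : {morph dsum_reindex_fun : f g / f + g}.
Proof. by move=> f g; apply: dsumP => j; rewrite [RHS]dsumDE; exact: dsumDE. Qed.

Definition dsum_reindex : {linear dsum R I -> dsum R J} :=
  linear_of dsum_reindex_funZ dsum_reindex_funD.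

End Reindex.

(** Clamping the index prolongs a vector by repeating its last entry; the length [n.+1] ensures that
    there is one. *)
Definition truncate_ord n k : 'I_n.+1 := inord (minn k n).

Lemma val_truncate_ord n k : truncate_ord n k = minn k n :> nat.
Proof. by rewrite inordK// ltnS geq_minr. Qed.

Definition evconst_system_map i j (_ : (i <= j)%N) :
    {linear dsum R 'I_i.+1 -> dsum R 'I_j.+1} :=
  dsum_reindex (fun k : 'I_j.+1 => truncate_ord i k).

Lemma evconst_system_map_id i (ii : (i <= i)%N) f : evconst_system_map ii f = f.
Proof.
apply: dsumP => k /=; congr (f _); apply: val_inj.
by rewrite /= val_truncate_ord (minn_idPl _)// -ltnS.
Qed.

Lemma evconst_system_map_comp i j k (ij : (i <= j)%N) (jk : (j <= k)%N)
    (ik : (i <= k)%N) f :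
  evconst_system_map jk (evconst_system_map ij f) = evconst_system_map ik f.
Proof.
apply: dsumP => l /=; congr (f _); apply: val_inj.
by rewrite /= !val_truncate_ord -minnA (minn_idPr ij).
Qed.

Lemma leq_directed i j : exists k, (i <= k)%N /\ (j <= k)%N.
Proof. by exists (maxn i j); rewrite leq_maxl leq_maxr. Qed.

Definition evconst_system : directed_system R :=
  @DirectedSystem R nat leq (fun n => dsum R 'I_n.+1) evconst_system_map
    (inhabits 0%N) leqnn (fun i j k => @leq_trans j i k) leq_directed
    evconst_system_map_id evconst_system_map_comp.

Section Extend.
Variable n : nat.

Lemma dsum_extend_subproof (f : dsum R 'I_n.+1) :
  (fun k => f (truncate_ord n k)) \in evconst_pred.
Proof.
apply/asboolP; exists n => k nk; congr (f _); apply: val_inj.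
by rewrite /= !val_truncate_ord minnn (minn_idPr nk).
Qed.

Definition dsum_extend_fun (f : dsum R 'I_n.+1) : evconst :=
  EvConst (dsum_extend_subproof f).

Lemma dsum_extend_funZ a f : dsum_extend_fun (a *: f) = a *: dsum_extend_fun f.
Proof. exact: evconstP. Qed.

Lemma dsum_extend_funD : {morph dsum_extend_fun : f g / f + g}.
Proof.
by move=> f g; apply: evconstP => k; rewrite evconstDE; exact: dsumDE.
Qed.

Definition dsum_extend : {linear dsum R 'I_n.+1 -> evconst} :=
  linear_of dsum_extend_funZ dsum_extend_funD.

Lemma evconst_restrict_subproof (f : evconst) :
  (fun k : 'I_n.+1 => f k) \in finsupp (I := 'I_n.+1).
Proof. by apply/asboolP; exact: finite_finset. Qed.

Definition evconst_restrict (f : evconst) : dsum R 'I_n.+1 :=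
  DSum (evconst_restrict_subproof f).

Lemma dsum_extendK : cancel dsum_extend evconst_restrict.
Proof.
move=> f; apply: dsumP => k /=; congr (f _); apply: val_inj.
by rewrite /= val_truncate_ord (minn_idPl _)// -ltnS.
Qed.

Lemma evconst_restrictK (f : evconst) :
  (forall k, (n <= k)%N -> f k = f n) -> dsum_extend (evconst_restrict f) = f.
Proof.
move=> fn; apply: evconstP => k /=; rewrite val_truncate_ord.
by have [nk|/ltnW kn] := leqP n k; rewrite ?(minn_idPr nk) ?(minn_idPl kn)// fn.
Qed.

End Extend.

Lemma dsum_extend_map i j (ij : (i <= j)%N) f :
  dsum_extend j (evconst_system_map ij f) = dsum_extend i f.
Proof.
apply: evconstP => k /=; congr (f _); apply: val_inj.
by rewrite /= !val_truncate_ord -minnA (minn_idPr ij).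
Qed.

(** The stages embed as the sequences constant from [n] on and exhaust [evconst], so compatible
    linear maps glue in exactly one way. *)
Lemma evconst_flat : flat evconst.
Proof.
exists evconst_system, dsum_extend; split.
  by move=> n; exists n.+1, (@idfun (dsum R 'I_n.+1)); exists id.
split; first by move=> i j ij f; exact: dsum_extend_map.
move=> N d dP.
have /choice[r rP] (f : evconst) : exists n, forall k, (n <= k)%N -> f k = f n.
  by case: f => f /= /asboolP.
pose u f := d (r f) (evconst_restrict (r f) f).
have uE i g : u (dsum_extend i g) = d i g.
  rewrite /u; set f := dsum_extend i g.
  (* Both stages map into stage [k], where extension is injective. *)
  have [k [ik rk]] := leq_directed i (r f).
  rewrite -(dP _ _ rk) -(dP _ _ ik); congr (d k _).
  apply: (can_inj (@dsum_extendK k)).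
  rewrite [LHS]dsum_extend_map [RHS]dsum_extend_map.
  by rewrite evconst_restrictK//; exact: rP.
have repr2 f g : exists n f' g', f = dsum_extend n f' /\ g = dsum_extend n g'.
  have [n [fn gn]] := leq_directed (r f) (r g).
  exists n, (evconst_system_map fn (evconst_restrict (r f) f)),
    (evconst_system_map gn (evconst_restrict (r g) g)).
  by rewrite !dsum_extend_map !evconst_restrictK//; exact: rP.
have uZ a f : u (a *: f) = a *: u f.
  have [n [f' [_ [-> _]]]] := repr2 f f.
  by rewrite -[in LHS]linearZ !uE linearZ.
have uD : {morph u : f g / f + g}.
  move=> f g; have [n [f' [g' [-> ->]]]] := repr2 f g.
  by rewrite -[in LHS]linearD !uE linearD.
exists (linear_of uZ uD); split; first exact: uE.
move=> v vP f; have [n [f' [_ [-> _]]]] := repr2 f f.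
by rewrite [LHS]vP [RHS]uE.
Qed.

End EventuallyConstant.

(** * The zerosumfree case *)

Section ZerosumfreeSimple.
Variables (R : pzSemiRingType) (e : R).
Hypotheses (dive : division_idempotent e) (fulle : full_element e).
Hypothesis csR : congruence_simple R.
Hypothesis zsfR : forall x y : R, x + y = 0 -> x = 0.

(* Without zero divisors in [e R e] and without opposites, vanishing of all
   the matrix entries [e * a * x * b * e] only depends on [x] up to a
   congruence, which is trivial by simplicity. *)
Lemma eq_corner_vanish (x y : R) :
  (forall a b, e * a * x * b * e = 0 <-> e * a * y * b * e = 0) -> x = y.
Proof.
pose E x y := forall a b, e * a * x * b * e = 0 <-> e * a * y * b * e = 0.
have [e0 ee _] := dive.
have addE (u v : R) : u + v = 0 <-> u = 0 /\ v = 0.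
  split=> [uv|[-> ->]]; last by rewrite addr0.
  by split; [exact: zsfR uv | apply: (@zsfR v u); rewrite addrC].
have congE : congruence E.
  split=> [x' a b|x' y' xy a b|x' y' z' xy yz a b|x' y' z' t' xy zt] //.
  - by symmetry.
  - by rewrite xy.
  - split=> a b; first by rewrite !(mulrDr, mulrDl) !addE xy zt.
    (* One factor is replaced at a time, the other being absorbed into [b] or [a]. *)
    have -> : e * a * (x' * z') * b * e = e * a * x' * (z' * b) * e.
      by rewrite !mulrA.
    rewrite xy; have -> : e * a * y' * (z' * b) * e = e * (a * y') * z' * b * e.
      by rewrite !mulrA.
    by rewrite zt !mulrA.
have [/(_ x y)[]//|/(_ 1 0)/(_ 1 1)] := csR congE.
by rewrite !mulr1 mulr0 !mul0r ee => -[_ /(_ erefl)].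
Qed.

(** Without opposites, a doubled entry vanishes exactly when the entry does. *)
Lemma addrr_idem (x : R) : x + x = x.
Proof.
apply: eq_corner_vanish => a b; rewrite !(mulrDr, mulrDl).
by split=> [/zsfR//|->]; rewrite addr0.
Qed.

(** As [e R e] has no zero divisors, all its nonzero elements have the same vanishing entries, and
    [e] is one of them. *)
Lemma corner_eq x : e * x * e <> 0 -> e * x * e = e.
Proof.
move=> x0; have [e0 ee _] := dive.
have cM y z : (e * y * e) * (e * z * e) = e * (y * e * z) * e.
  by rewrite !mulrA -[_ * e * e]mulrA ee.
suff H z : e * z * e <> 0 -> forall a b,
    e * a * (e * z * e) * b * e = 0 <-> e * a * e = 0 \/ e * b * e = 0.
  apply: eq_corner_vanish => a b; rewrite H//.
  by rewrite -[X in e * a * X * b](_ : e * 1 * e = e) ?H// mulr1 ee.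
move=> z0 a b; have -> : e * a * (e * z * e) * b * e =
    (e * a * e) * (e * z * e) * (e * b * e).
  by rewrite !cM !mulrA.
split=> [ab|[->|->]]; rewrite ?mulr0 ?mul0r//.
apply: contrapT => /not_orP[a0 b0].
have az0 := corner_mul_neq0 dive a0 z0; rewrite cM in ab az0.
exact: (corner_mul_neq0 dive az0 b0).
Qed.

Definition evconst_cst (a : R) : evconst R.
Proof. by exists (fun=> a); apply/asboolP; exists 0%N. Defined.

Definition evconst_delta (n : nat) : evconst R.
Proof.
exists (fun k => if k == n then 1 else 0); apply/asboolP; exists n.+1 => k nk.
by rewrite gtn_eqF// gtn_eqF.
Defined.

(* In a free semimodule the elements [e *: f] below a given one are finite in
   number, since their supports are bounded and [e R] is finite: it consists
   of the subsums of [\sum e * b], where [1 = \sum a * e * b]. The elements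
   [e *: evconst_delta n] all lie below [e *: evconst_cst 1]. *)
Lemma evconst_not_projective : ~ projective (evconst R).
Proof.
move=> /projectiveP[I [i [p ip]]]; have [e0 ee _] := dive.
have [t t1] := fulle; have [s us sP] := dsum_supp_seq (i (e *: evconst_cst 1)).
pose x n := i (evconst_delta n).
have xE n j : i (e *: evconst_delta n) j = e * x n j by rewrite linearZ.
have x_supp n j : (j : {classic I}) \notin s -> e * x n j = 0.
  move=> js; have ij : i (e *: evconst_cst 1) j = 0.
    by apply: contrapT => /sP /=; exact/negP.
  (* Adding [e *: evconst_delta n] to [e *: evconst_cst 1] changes nothing, so its coordinate at [j]
     is a summand of 0. *)
  apply: (@zsfR _ (i (e *: evconst_cst 1) j)).
  rewrite -xE -dsumDE -linearD -[RHS]ij; congr (i _ j).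
  apply: evconstP => k; rewrite evconstDE !evconstZE /=.
  by case: eqP; rewrite ?mulr1 ?mulr0 ?add0r// addrr_idem.
(* The code records which corner entries vanish; the others equal [e], so it determines
   [i (e *: evconst_delta n)]. *)
pose code n : {ffun 'I_(size s) * 'I_(size t) -> bool} :=
  [ffun u => `[< e * (x n (tnth (in_tuple s) u.1) *
                      (tnth (in_tuple t) u.2).1) * e = 0 >]].
have code_inj : injective code.
  move=> m n mn; apply: contrapT => /eqP mDn.
  have /(congr1 p) : i (e *: evconst_delta m) = i (e *: evconst_delta n).
    apply: dsumP => j; rewrite !xE.
    have [js|js] := boolP ((j : {classic I}) \in s); last by rewrite !x_supp.
    have /(@tnthP _ {classic I})[v jE] : (j : {classic I}) \in in_tuple s by [].
    rewrite -[LHS]mulr1 -[RHS]mulr1 t1 !mulr_sumr; apply: eq_big_seq => q qt.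
    have /tnthP[u qE] : q \in in_tuple t by [].
    move: mn => /ffunP/(_ (v, u)); rewrite !ffunE /= -jE -qE.
    move=> mn; suff mnE : e * (x m j * q.1) * e = e * (x n j * q.1) * e.
      by rewrite !mulrA in mnE *; rewrite mnE.
    case: asboolP mn => [-> /esym/asboolP -> //|m0 /esym/asboolP n0].
    exact: etrans (corner_eq m0) (esym (corner_eq n0)).
  (* Comparing the two sequences at [m] gives [e = 0]. *)
  rewrite !ip => /(congr1 (@evconst_val R)) /(congr1 (@^~ m)).
  by rewrite !evconstZE /= eqxx (negPf mDn) mulr1 mulr0.
(* Pigeonhole, with one more index than there are codes. *)
suff /leq_card : injective
    (code \o @nat_of_ord (#|{ffun 'I_(size s) * 'I_(size t) -> bool}|.+1)).
  by rewrite card_ord ltnn.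
by move=> m n /code_inj; exact: val_inj.
Qed.

End ZerosumfreeSimple.

(** * The equivalence and its right-handed form *)

Lemma left_perfect_iff (R : pzSemiRingType) :
  simple_semiring R -> has_projective_minimal_left_ideal R ->
  (left_perfect R <-> artinian_simple_ring R).
Proof.
move=> [isR csR] /division_idempotent_of_projective[e dive].
have [e0 _ _] := dive; have fulle := full_of_ideal_simple isR e0.
split=> [perfR|[ringR _ _ _ _] M _]; last exact: projective_of_full dive fulle ringR M.
have ringR : is_ring R.
  have [//|zsfR] := ring_or_zerosumfree isR.
  have := perfR _ (evconst_flat R).
  by move=> /(evconst_not_projective dive fulle csR zsfR).
split=> //; first by move=> R0; apply: e0; rewrite -[LHS]mul1r R0 mul0r.
  exact: left_artinian_of_full dive fulle ringR.
(* The right chain condition is the left one over [R^c], where [e] is full by swapping the pairs. *)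
apply: (@left_artinian_of_full R^c e) => //; first exact: division_idempotent_conv.
have [s sE] := fulle; exists [seq (p.2, p.1) | p <- s].
by rewrite big_map [LHS]sE; apply: eq_bigr => p _; rewrite -mulrA.
Qed.

Lemma ideal_simple_conv (R : pzSemiRingType) : ideal_simple R -> ideal_simple R^c.
Proof. by move=> isR A [lA rA]; apply: isR. Qed.

Lemma simple_semiring_conv (R : pzSemiRingType) :
  simple_semiring R -> simple_semiring R^c.
Proof.
move=> [isR csR]; split; first exact: ideal_simple_conv.
move=> E [E1 E2 E3 E4]; apply: csR; split=> // x x' y y' xx' yy'.
by split; [case: (E4 _ _ _ _ xx' yy') | case: (E4 _ _ _ _ yy' xx')].
Qed.

(** Passing to [R^c] exchanges the two chain conditions and preserves the others. *)
Lemma artinian_simple_ring_conv (R : pzSemiRingType) :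
  artinian_simple_ring R^c <-> artinian_simple_ring R.
Proof.
split=> -[ringR R1 isR lR rR]; split=> //; exact: (ideal_simple_conv isR).
Qed.

Theorem corollary5p16 (R : pzSemiRingType) (simpleR : simple_semiring R) :
  (has_projective_minimal_left_ideal R ->
     (left_perfect R <-> artinian_simple_ring R)) /\
  (has_projective_minimal_right_ideal R ->
     (right_perfect R <-> artinian_simple_ring R)).
Proof.
split=> projI; first exact: left_perfect_iff.
rewrite -artinian_simple_ring_conv.
exact: (left_perfect_iff (simple_semiring_conv simpleR) projI).
Qed.
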